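(* Let $\mathcal{G}$ be a compact group acting continuously on a sample space $\mathcal{Y}$, let $\mathbb{Q}$ be a probability measure on $\mathcal{Y}$ with group average $\overline{\mathbb{Q}}$, and let $\mathbb{Q} = \mathbb{Q}_a + \mathbb{Q}_s$ be the Lebesgue decomposition of $\mathbb{Q}$ with respect to $\overline{\mathbb{Q}}$. Let $\alpha \in (0,1]$ and consider the utility $U(x) = x \wedge 1/\alpha$. Let $\varepsilon^{\mathrm{NP}} : \mathcal{Y} \to [0,\infty]$ be measurable and suppose that for every orbit $O$ there exist constants $\lambda_O \geq 0$ and $k_O \in [0,1/\alpha]$ such that, $\mathrm{Unif}(O)$-a.s., $$\varepsilon^{\mathrm{NP}} = \begin{cases} 0, & \text{if } \frac{d\mathbb{Q}_a}{d\overline{\mathbb{Q}}} < \lambda_O,\\ k_O, & \text{if } \frac{d\mathbb{Q}_a}{d\overline{\mathbb{Q}}} = \lambda_O,\\ 1/\alpha, & \text{if } \frac{d\mathbb{Q}_a}{d\overline{\mathbb{Q}}} > \lambda_O,\end{cases}$$ and $\varepsilon^{\mathrm{NP}}$ is an exact e-value for $\mathrm{Unif}(O)$, i.e. $\mathbb{E}^{\mathrm{Unif}(O)}[\varepsilon^{\mathrm{NP}}] = 1$; and suppose $\varepsilon^{\mathrm{NP}} = \infty$, $\mathbb{Q}_s$-a.s. Then $\varepsilon^{\mathrm{NP}}$ is Neyman--Pearson optimal, i.e. $U$-optimal against $\mathbb{Q}$ for $U(x) = x \wedge 1/\alpha$.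
   Context: All spaces are second-countable locally compact Hausdorff, equipped with their Borel $\sigma$-algebras. $\overline{G}$ follows the Haar probability measure on $\mathcal{G}$. The orbit of $y$ is $O_y = \{Gy : G \in \mathcal{G}\}$; $\mathrm{Unif}(O)$ is the law of $\overline{G}y$ for any $y \in O$. The group average of $\mathbb{Q}$ is $\overline{\mathbb{Q}}(A) = \mathbb{E}_{\overline{G}}[\mathbb{Q}(\overline{G}^{-1}A)]$. A probability $\mathbb{P}$ is $\mathcal{G}$ invariant if $\mathbb{P}(G^{-1}A) = \mathbb{P}(A)$ for all $G, A$. A measurable $\varepsilon : \mathcal{Y} \to [0,\infty]$ is valid for $\mathcal{G}$ invariance if $\mathbb{E}^{\mathbb{P}}[\varepsilon] \leq 1$ for every $\mathcal{G}$ invariant probability $\mathbb{P}$. An e-value $\varepsilon^*$ that is valid for $\mathcal{G}$ invariance, with $\varepsilon^* = \infty$ $\mathbb{Q}_s$-a.s., is $U$-optimal against $\mathbb{Q}$ if $\mathbb{E}^{\mathbb{Q}_a}[U(\varepsilon^* )] \geq \mathbb{E}^{\mathbb{Q}_a}[U(\varepsilon)]$ for every e-value $\varepsilon$ valid for $\mathcal{G}$ invariance (with $\varepsilon=\infty$ imposed $\mathbb{Q}_s$-a.s.), whenever both sides are well-defined; here $\mathbb{E}^{\mathbb{Q}_a}$ denotes integration against the sub-probability $\mathbb{Q}_a$. *)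

(* Defs.v *)
From HB Require Import structures.
From mathcomp Require Import all_boot all_order all_algebra.
From mathcomp Require Import all_classical all_reals all_analysis measurable_realfun.

Set Implicit Arguments.
Unset Strict Implicit.
Unset Printing Implicit Defensive.

Import Order.TTheory GRing.Theory Num.Theory.
Import numFieldNormedType.Exports.

Local Open Scope classical_set_scope.
Local Open Scope ring_scope.
Local Open Scope ereal_scope.
Local Open Scope charge_scope.

HB.mixin Record isTopologicalGroup G & Topological G & Group G := {
  mulg_continuous : continuous (fun p : G * G => (p.1 * p.2)%g) ;
  invg_continuous : continuous (fun g : G => g^-1%g)
}.

(* The library's measurable types are pointed, hence so are the spaces here.  *)
(* This costs no generality: a group and a space carrying a probability       *)
(* measure are nonempty. The distinguished point of G need not be 1.          *)
#[short(type="topGroupType")]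
HB.structure Definition TopologicalGroup :=
  {G of Group G & PointedTopological G & isTopologicalGroup G}.

Notation borel T := (g_sigma_algebraType (@open T)).

Definition second_countable_lcH (T : topologicalType) : Prop :=
  [/\ @second_countable T, locally_compact [set: T] & hausdorff_space T].

Record continuous_action (G : topGroupType) (Y : topologicalType) := {
  act :> G -> Y -> Y ;
  act1 : forall y, act 1%g y = y ;
  actM : forall g h y, act (g * h)%g y = act g (act h y) ;
  act_continuous : continuous (fun p : G * Y => act p.1 p.2)
}.

(* Left invariance characterizes the Haar probability of a compact            *)
(* second-countable group: right invariance, uniqueness and regularity follow *)
(* from it.                                                                   *)
Definition is_haar (R : realType) (G : topGroupType)
    (mu : probability (borel G) R) : Prop :=
  forall (g : G) (A : set (borel G)), measurable A ->
    mu [set (g * h)%g | h in A] = mu A.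

Definition orbit (G : topGroupType) (Y : topologicalType)
    (a : continuous_action G Y) (y : Y) : set Y := range (fun g => a g y).

Definition orbits (G : topGroupType) (Y : topologicalType)
    (a : continuous_action G Y) : set (set Y) := range (orbit a).

Definition orbit_map (G : topGroupType) (Y : ptopologicalType)
    (a : continuous_action G Y) (y : Y) : borel G -> borel Y := fun g => a g y.

Lemma measurable_orbit_map (G : topGroupType) (Y : ptopologicalType)
    (a : continuous_action G Y) (y : Y) :
  measurable_fun [set: borel G] (orbit_map a y).
Proof.
apply: (@measurability _ _ (borel G) (borel Y) setT _ (@open Y)) => // _ [B oB <-].
rewrite setTI; apply: sub_sigma_algebra.
suff /continuousP/(_ _ oB) : continuous (fun g : G => a g y) by [].
move=> g; apply: (@continuous_comp G (G * Y)%type Y (fun g => (g, y))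
  (fun p => a p.1 p.2)); last exact: act_continuous.
by apply: cvg_pair; [exact: cvg_id|exact: cvg_cst].
Qed.

HB.instance Definition _ (G : topGroupType) (Y : ptopologicalType)
    (a : continuous_action G Y) (y : Y) :=
  isMeasurableFun.Build _ _ (borel G) (borel Y) (orbit_map a y)
    (measurable_orbit_map a y).

(* The law of (Gbar y) for a point y of O picked by choice; by the right      *)
(* invariance of the Haar probability the law is the same for every y in O.   *)
Definition Unif (R : realType) (G : topGroupType) (Y : ptopologicalType)
    (a : continuous_action G Y) (mu : probability (borel G) R)
    (O : set Y) : probability (borel Y) R :=
  distribution mu (orbit_map a (get O)).

Definition translate (G : topGroupType) (Y : topologicalType)
    (a : continuous_action G Y) (g : G) (A : set Y) : set Y := a g @` A.

Definition group_average (R : realType) (G : topGroupType)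
    (Y : ptopologicalType) (a : continuous_action G Y)
    (mu : probability (borel G) R) (Q : probability (borel Y) R)
    (A : set (borel Y)) : \bar R :=
  \int[mu]_g Q (translate a g^-1%g A).

Definition invariant (R : realType) (G : topGroupType) (Y : ptopologicalType)
    (a : continuous_action G Y) (P : probability (borel Y) R) : Prop :=
  forall (g : G) (A : set (borel Y)), measurable A ->
    P (translate a g^-1%g A) = P A.

Definition mutually_singular d (T : measurableType d) (R : realType)
    (mu nu : {measure set T -> \bar R}) : Prop :=
  exists2 N : set T, measurable N & mu N = 0 /\ nu (~` N) = 0.

Definition lebesgue_decomposition d (T : measurableType d) (R : realType)
    (nu mu nua nus : {measure set T -> \bar R}) : Prop :=
  [/\ forall A, measurable A -> nu A = nua A + nus A,
      nua `<< mu & mutually_singular mu nus].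

(* f is a version of dnu/dmu: the Radon-Nikodym derivative is only determined *)
(* up to a mu-null set, and the library's 'd _ '/d _ is one chosen version.   *)
Definition is_RN_derivative d (T : measurableType d) (R : realType)
    (nu : {finite_measure set T -> \bar R})
    (mu : {sigma_finite_measure set T -> \bar R}) (f : T -> \bar R) : Prop :=
  measurable_fun [set: T] f /\
  f = ('d (charge_of_finite_measure nu) '/d mu) %[ae mu].

Definition evalue d (T : measurableType d) (R : realType)
    (eps : T -> \bar R) : Prop :=
  measurable_fun [set: T] eps /\ forall y, 0 <= eps y.

Definition valid_for_invariance (R : realType) (G : topGroupType)
    (Y : ptopologicalType) (a : continuous_action G Y)
    (eps : borel Y -> \bar R) : Prop :=
  evalue eps /\
  forall P : probability (borel Y) R, invariant a P -> \int[P]_y eps y <= 1.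

(* The integral of f is not of the indeterminate form +oo - oo. *)
Definition integral_defined d (T : measurableType d) (R : realType)
    (mu : {measure set T -> \bar R}) (f : T -> \bar R) : Prop :=
  measurable_fun [set: T] f /\
  (\int[mu]_y f^\+ y +? - \int[mu]_y f^\- y).

(* Qa and Qs stand for the two parts of the Lebesgue decomposition of the     *)
(* alternative with respect to its group average.                             *)
Definition U_optimal (R : realType) (G : topGroupType) (Y : ptopologicalType)
    (a : continuous_action G Y) (Qa Qs : {measure set (borel Y) -> \bar R})
    (U : \bar R -> \bar R) (eps : borel Y -> \bar R) : Prop :=
  [/\ valid_for_invariance a eps,
      \forall y \ae Qs, eps y = +oo &
      forall eps' : borel Y -> \bar R,
        valid_for_invariance a eps' ->
        (\forall y \ae Qs, eps' y = +oo) ->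
        integral_defined Qa (U \o eps) ->
        integral_defined Qa (U \o eps') ->
        \int[Qa]_y U (eps' y) <= \int[Qa]_y U (eps y)].

Definition NP_utility (R : realType) (alpha : R) (x : \bar R) : \bar R :=
  Order.min x (alpha^-1)%:E.

(* Main.v *)
Require Import Defs.
From HB Require Import structures.
From mathcomp Require Import all_boot all_order all_algebra.
From mathcomp Require Import all_classical all_reals all_analysis measurable_realfun.
From mathcomp Require Import lra.

Import Order.TTheory GRing.Theory Num.Theory.
Import numFieldNormedType.Exports.

Local Open Scope classical_set_scope.
Local Open Scope ring_scope.
Local Open Scope ereal_scope.

Set Implicit Arguments.
Unset Strict Implicit.
Unset Printing Implicit Defensive.

(** Averaging over the group reduces the claim to the Neyman-Pearson lemma on
    a single orbit.

    The Haar probability mu is also right invariant ([haar_integral_mulgr]), so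
    that the integral of a nonnegative f against Unif (G y) is that of
    g |-> f (g y) against mu ([integral_Unif]). For an invariant probability P,
    the integral of f (g y) over y does not depend on g; exchanging the
    integrals over g and y therefore shows that P is the mixture over y ~ P of
    the laws Unif (G y) ([invariant_disintegration]). Validity of epsNP follows,
    since its expectation is 1 under each of these laws.

    The same mixture formula applies to Qbar, which is invariant
    ([invariant_group_average]). As Qa has density dQa with respect to Qbar, the
    expected utility of an e-value eps under Qa is the average over the orbits
    of the integral of min(eps, 1/alpha) * dQa against Unif (G y). Each law
    Unif (G y) is itself invariant ([invariant_Unif]), so a valid eps has mean
    at most 1 under it, which is the mean of epsNP. On each orbit epsNP is a
    likelihood ratio test with values in [0, 1/alpha], hence maximizes this
    integral under that constraint ([neyman_pearson]).

    The exchanges of integrals need the action and the group law to be jointly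
    measurable for the product of the Borel sigma-algebras; by second
    countability this sigma-algebra contains the open sets of the product
    ([open_measurable_setX]). *)

(** * Borel sets of a product *)

(** An open set is the union of the products of basic open sets that it
    contains, and there are countably many of them. *)
Lemma open_measurable_setX (T1 T2 : ptopologicalType) (W : set (T1 * T2)) :
  @second_countable T1 -> @second_countable T2 -> open W ->
  measurable (W : set (borel T1 * borel T2)).
Proof.
move=> [B1 cB1 [oB1 bB1]] [B2 cB2 [oB2 bB2]] oW.
pose D : set (set T1 * set T2) :=
  (B1 `*` B2) `&` [set V | V.1 `*` V.2 `<=` W].
have -> : W = \bigcup_(V in D) (V.1 `*` V.2).
  apply/seteqP; split => [[x y] Wxy|[x y] [V [_ VW] /VW]//].
  have [[U1 U2] [/= /bB1[V1 [BV1 V1x] V1U] /bB2[V2 [BV2 V2y] V2U]] UW] :=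
    open_nbhs_nbhs (conj oW Wxy).
  exists (V1, V2) => //; split=> // -[u v] [/= /V1U Uu /V2U Uv].
  exact: UW.
rewrite bigcup_set_type; apply: countable_bigcupT_measurable.
  rewrite (eq_countable (card_setT _)).
  exact: sub_countable (subset_card_le (@subIsetl _ _ _)) (countableX cB1 cB2).
move=> [V /= /set_mem[[V1 V2] _]].
by apply: measurableX; apply: sub_sigma_algebra; [exact: oB1|exact: oB2].
Qed.

Lemma continuous_measurable_setX (T1 T2 T3 : ptopologicalType)
    (f : T1 * T2 -> T3) :
  @second_countable T1 -> @second_countable T2 -> continuous f ->
  measurable_fun [set: borel T1 * borel T2] (f : borel T1 * borel T2 -> borel T3).
Proof.
move=> sT1 sT2 cf.
apply: (@measurability _ _ _ (borel T3) setT _ (@open T3)) => // _ [B oB <-].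
rewrite setTI; apply: open_measurable_setX => //.
by move/continuousP : cf; exact.
Qed.

Lemma probability_integral_cst d (T : measurableType d) (R : realType)
    (P : probability T R) (c : \bar R) : \int[P]_x c = c.
Proof. by rewrite integral_cst// [X in _ * X]probability_setT mule1. Qed.

Lemma translateVE (G : topGroupType) (Y : topologicalType)
    (a : continuous_action G Y) (g : G) (A : set Y) :
  translate a g^-1%g A = a g @^-1` A.
Proof.
apply/seteqP; split => [_ [y Ay <-]|y Ay] /=.
  by rewrite -actM mulgV act1.
by exists (a g y) => //; rewrite -actM mulVg act1.
Qed.

(** * Haar probability *)

Section haar.
Context (R : realType) (G : topGroupType) (mu : probability (borel G) R).
Hypothesis hmu : is_haar mu.
Hypothesis scG : @second_countable G.
Implicit Type f : borel G -> \bar R.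

Lemma measurable_mulg :
  measurable_fun [set: borel G * borel G]
    ((fun p => (p.1 * p.2)%g) : borel G * borel G -> borel G).
Proof. by apply: continuous_measurable_setX => //; exact: mulg_continuous. Qed.

Lemma measurable_invg :
  measurable_fun [set: borel G] ((fun g => g^-1%g) : borel G -> borel G).
Proof.
apply: (@measurability _ _ _ (borel G) setT _ (@open G)) => // _ [B oB <-].
rewrite setTI; apply: sub_sigma_algebra.
by have /continuousP := @invg_continuous G; exact.
Qed.

Lemma measurable_mulgl (g : G) :
  measurable_fun [set: borel G] ((fun h => (g * h)%g) : borel G -> borel G).
Proof. exact: (measurable_fun_pair2 _ measurable_mulg). Qed.

Lemma haar_integral_mulgl f (g : G) : measurable_fun setT f ->
  (forall h, 0 <= f h) -> \int[mu]_h f (g * h)%g = \int[mu]_h f h.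
Proof.
move=> mf f0.
rewrite -(@ge0_integral_pushforward _ _ _ _ _ _ (measurable_mulgl g) mu setT f)//.
apply: eq_measure_integral => [|? A mA _]; first exact: measurable_mulgl.
transitivity (mu [set (g^-1 * h)%g | h in A]); last exact: hmu.
congr (mu _); apply/seteqP; split => [h Ah|_ [h Ah <-]] /=.
  by exists (g * h)%g => //; rewrite mulKg.
by rewrite mulVKg.
Qed.

(** The double integral of f (g^-1 h) reduces to the integral of f by left
    invariance in h, and, as g^-1 h = (h^-1 g)^-1, to that of the function
    g |-> f g^-1 by left invariance in g. *)
Lemma haar_integral_invg f : measurable_fun setT f ->
  (forall h, 0 <= f h) -> \int[mu]_h f h^-1%g = \int[mu]_h f h.
Proof.
move=> mf f0.
pose F (p : borel G * borel G) : \bar R := f (p.1^-1 * p.2)%g.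
have mF : measurable_fun setT F.
  apply: (measurableT_comp mf).
  have := measurableT_comp measurable_mulg (measurable_fun_pair
    (measurableT_comp measurable_invg (@measurable_fst _ _ (borel G) (borel G)))
    (@measurable_snd _ _ (borel G) (borel G))).
  exact.
have F0 p : 0 <= F p by exact: f0.
have FE : \int[mu]_g \int[mu]_h F (g, h) = \int[mu]_h f h.
  transitivity (\int[mu]_g \int[mu]_h f h).
    by apply: eq_integral => g _; exact: (haar_integral_mulgl g^-1%g mf f0).
  by rewrite probability_integral_cst.
rewrite -FE fubini_tonelli//.
have mfV : measurable_fun setT (fun h : borel G => f h^-1%g).
  exact: (measurableT_comp mf measurable_invg).
transitivity (\int[mu]_h \int[mu]_g f g^-1%g).
  by rewrite probability_integral_cst.
apply: eq_integral => h _.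
rewrite -(haar_integral_mulgl h^-1%g mfV)//.
by apply: eq_integral => g _; rewrite invgM invgK.
Qed.

(** Inversion turns right translations into left ones. *)
Lemma haar_integral_mulgr f (h : G) : measurable_fun setT f ->
  (forall g, 0 <= f g) -> \int[mu]_g f (g * h)%g = \int[mu]_g f g.
Proof.
move=> mf f0.
have mfV : measurable_fun setT (fun g : borel G => f g^-1%g).
  exact: (measurableT_comp mf measurable_invg).
rewrite -[RHS]haar_integral_invg// -(haar_integral_mulgl h^-1%g mfV)//.
under [RHS]eq_integral do rewrite invgM invgK.
rewrite (@haar_integral_invg (fun g : borel G => f (g * h)%g))//.
exact: (measurableT_comp mf (measurable_fun_pair1 _ measurable_mulg)).
Qed.

End haar.

(** * Invariant probabilities as mixtures of orbit laws *)

Section invariant_probability.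
Context (R : realType) (G : topGroupType) (Y : ptopologicalType).
Context (a : continuous_action G Y) (mu : probability (borel G) R).
Hypothesis hmu : is_haar mu.
Hypothesis scG : @second_countable G.
Hypothesis scY : @second_countable Y.
Implicit Type f : borel Y -> \bar R.

Lemma measurable_act :
  measurable_fun [set: borel G * borel Y]
    ((fun p => a p.1 p.2) : borel G * borel Y -> borel Y).
Proof. by apply: continuous_measurable_setX => //; exact: act_continuous. Qed.

(** Right invariance of mu makes the base point y irrelevant: the point h y of
    the orbit that [Unif] picks gives the same integral. *)
Lemma integral_Unif f (y : Y) : measurable_fun setT f ->
  (forall z, 0 <= f z) ->
  \int[Unif a mu (Defs.orbit a y)]_z f z = \int[mu]_g f (a g y).
Proof.
move=> mf f0; rewrite /Unif ge0_integral_distribution//=.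
have : Defs.orbit a y (get (Defs.orbit a y)).
  by apply: (@getPex _ (Defs.orbit a y)); exists (a 1%g y); exists 1%g.
move=> [h _ /= <-].
transitivity (\int[mu]_g f (a (g * h)%g y)).
  by apply: eq_integral => g _; rewrite actM.
rewrite (haar_integral_mulgr hmu scG (f := fun g => f (a g y)))//.
exact: (measurableT_comp mf (measurable_fun_pair1 _ measurable_act)).
Qed.

Lemma invariant_integral (P : probability (borel Y) R) f (g : G) :
  Defs.invariant a P -> measurable_fun setT f -> (forall z, 0 <= f z) ->
  \int[P]_y f (a g y) = \int[P]_y f y.
Proof.
move=> iP mf f0.
have mg : measurable_fun setT (a g : borel Y -> borel Y).
  exact: (measurable_fun_pair2 _ measurable_act).
rewrite -(@ge0_integral_pushforward _ _ _ _ _ _ mg P setT f)//.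
apply: eq_measure_integral => A mA _.
transitivity (P (translate a g^-1%g A)); last exact: iP.
by rewrite translateVE.
Qed.

(** A partial integral of the jointly measurable map (g, y) |-> f (g y). *)
Lemma measurable_integral_Unif f : measurable_fun setT f ->
  (forall z, 0 <= f z) ->
  measurable_fun [set: borel Y]
    (fun y => \int[Unif a mu (Defs.orbit a y)]_z f z).
Proof.
move=> mf f0; under eq_fun do rewrite integral_Unif//.
apply: (@measurable_fun_fubini_tonelli_G _ _ _ _ _ mu
  (fun p : borel G * borel Y => f (a p.1 p.2))) => //.
exact: (measurableT_comp mf measurable_act).
Qed.

(** After exchanging the integrals over G and Y, the integral over Y is
    constant in the group element by invariance, and mu has total mass 1. *)
Lemma invariant_disintegration (P : probability (borel Y) R) f :
  Defs.invariant a P -> measurable_fun setT f -> (forall z, 0 <= f z) ->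
  \int[P]_y f y = \int[P]_y \int[Unif a mu (Defs.orbit a y)]_z f z.
Proof.
move=> iP mf f0; under [RHS]eq_integral do rewrite integral_Unif//.
have mF : measurable_fun setT (fun p : borel G * borel Y => f (a p.1 p.2)).
  exact: (measurableT_comp mf measurable_act).
rewrite -(fubini_tonelli _ mF)//=.
under [RHS]eq_integral do rewrite invariant_integral//.
by rewrite probability_integral_cst.
Qed.

(** Applying a group element to the random point Gbar y of the orbit is a
    left translation of the Haar probability. *)
Lemma invariant_Unif (O : set Y) : Defs.invariant a (Unif a mu O).
Proof.
move=> g A mA; rewrite translateVE /Unif /distribution /pushforward.
rewrite -[RHS](hmu g^-1%g); last first.
  by rewrite -[X in measurable X]setTI; exact: measurable_orbit_map.
congr (mu _); apply/seteqP; split => [h Ah|_ [h Ah <-]] /=.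
  by exists (g * h)%g; [rewrite /= /orbit_map actM|rewrite mulKg].
by rewrite /orbit_map -actM mulVKg.
Qed.

(** Translating A by g turns the integrand h |-> Q (h^-1 A) into its left
    translate by g, which has the same Haar integral. *)
Lemma invariant_group_average (Q Qbar : probability (borel Y) R) :
  (forall A, measurable A -> Qbar A = group_average a mu Q A) ->
  Defs.invariant a Qbar.
Proof.
move=> hQbar g A mA; rewrite translateVE.
have mg : measurable_fun setT (a g : borel Y -> borel Y).
  exact: (measurable_fun_pair2 _ measurable_act).
have mgA : measurable (a g @^-1` A : set (borel Y)).
  by rewrite -[X in measurable X]setTI; exact: mg.
rewrite !hQbar// /group_average.
under eq_integral do rewrite translateVE.
under [RHS]eq_integral do rewrite translateVE.
(* measurable in h because Q (h^-1 A) is the measure of a section of B *)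
pose B : set (borel G * borel Y) := [set p | A (a p.1 p.2)].
have mB : measurable B.
  by rewrite -[B]setTI; exact: (measurable_act measurableT mA).
have E (h : borel G) : Q (a h @^-1` A) = (Q \o xsection B) h.
  by congr (Q _); apply/seteqP; split => y /=; rewrite /xsection /= inE.
have mE : measurable_fun setT (fun h : borel G => Q (a h @^-1` A)).
  by rewrite (_ : (fun _ => _) = Q \o xsection B); [exact: measurable_fun_xsection|
    apply/funext => h; exact: E].
rewrite -(haar_integral_mulgl hmu scG g mE)//.
apply: eq_integral => h _; congr (Q _).
by apply/seteqP; split => y /=; rewrite actM.
Qed.

End invariant_probability.

(** * Neyman-Pearson lemma *)

Definition threshold_test (R : realType) (lam k c : R) (r : \bar R) : \bar R :=
  if r < lam%:E then 0 else if r == lam%:E then k%:E else c%:E.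

Lemma threshold_test_le (R : realType) (lam k c : R) (r : \bar R) :
  (0 <= k <= c)%R -> threshold_test lam k c r <= c%:E.
Proof.
move=> /andP[k0 kc]; rewrite /threshold_test.
by case: ifP => _; [rewrite lee_fin (le_trans k0)|case: ifP => _; rewrite lee_fin].
Qed.

(** For real r >= 0 and t the value of the test, this is
    (t - p) * (r - lam) >= 0: the two factors have the same sign, because t is
    c >= p above the threshold and 0 <= p below it. The terms are moved so that
    no difference of infinite values occurs, and the density enters through its
    positive part because a version of the Radon-Nikodym derivative may be
    negative on a null set. *)
Lemma threshold_test_exchange (R : realType) (lam k c : R) (r p : \bar R) :
  (0 < c)%R -> (0 <= lam)%R -> 0 <= p <= c%:E ->
  p * maxe r 0 + lam%:E * threshold_test lam k c r <=
  threshold_test lam k c r * maxe r 0 + lam%:E * p.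
Proof.
move=> c0 lam0 /andP[]; case: p => [p|//|//]; rewrite !lee_fin => p0 pc.
rewrite /threshold_test; case: ltP => [rlam|].
  rewrite mule0 adde0 mul0e add0e muleC lee_wpmul2r ?lee_fin//.
  by rewrite ge_max (ltW rlam) lee_fin.
rewrite le_eqVlt eq_sym => /predU1P[->|lamr].
  by rewrite eqxx max_l ?lee_fin//; lra.
rewrite gt_eqF// max_l; last by rewrite (le_trans _ (ltW lamr))// lee_fin.
case: r lamr => [r|_|//].
  rewrite lte_fin -!EFinM -!EFinD lee_fin => lamr; nra.
by rewrite [c%:E * +oo]gt0_muley ?lte_fin// addye// leey.
Qed.

(** Integrating [threshold_test_exchange] gives the conclusion up to the terms
    lam * \int e and lam * \int p: the latter is at most the former, which is
    finite and cancels. The truncation of e at c only matters on a null set. *)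
Lemma neyman_pearson d (T : measurableType d) (R : realType)
    (m : {measure set T -> \bar R}) (r e p : T -> \bar R) (lam k c : R) :
  (0 < c)%R -> (0 <= lam)%R -> (0 <= k <= c)%R ->
  measurable_fun [set: T] r -> measurable_fun [set: T] e ->
  measurable_fun [set: T] p ->
  (forall y, 0 <= e y) -> (forall y, 0 <= p y <= c%:E) ->
  (\forall y \ae m, e y = threshold_test lam k c (r y)) ->
  \int[m]_y p y <= \int[m]_y e y -> \int[m]_y e y \is a fin_num ->
  \int[m]_y (p y * maxe (r y) 0) <= \int[m]_y (mine (e y) c%:E * maxe (r y) 0).
Proof.
move=> c0 lam0 kc mr me mp e0 pc eE pe fe.
have p0 y : 0 <= p y by case/andP : (pc y).
have mrp : measurable_fun setT (fun y => maxe (r y) 0) by exact: measurable_maxe.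
have mec : measurable_fun setT (fun y => mine (e y) c%:E) by exact: measurable_mine.
have r0 y : 0 <= maxe (r y) 0 by rewrite le_max lexx orbT.
have ec0 y : 0 <= mine (e y) c%:E by rewrite le_min e0 lee_fin ltW.
have flam : lam%:E * \int[m]_y e y \is a fin_num by rewrite fin_numM.
rewrite -(leeD2rE _ _ flam).
apply: (@le_trans _ _
  (\int[m]_y (mine (e y) c%:E * maxe (r y) 0) + lam%:E * \int[m]_y p y)); last first.
  by rewrite leeD2l// lee_wpmul2l// lee_fin.
rewrite -!ge0_integralZl//.
rewrite -!ge0_integralD//; try (by move=> y _; rewrite mule_ge0);
  try exact: emeasurable_funM; try exact: measurable_funeM.
apply: ae_ge0_le_integral => //.
- by move=> y _; rewrite adde_ge0// mule_ge0.
- by apply: emeasurable_funD; [exact: emeasurable_funM|exact: measurable_funeM].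
- by move=> y _; rewrite adde_ge0// mule_ge0.
- by apply: emeasurable_funD; [exact: emeasurable_funM|exact: measurable_funeM].
apply: filterS eE => y -> _.
by rewrite min_l ?threshold_test_le// threshold_test_exchange.
Qed.

(** * Change of measure and the optimality of the Neyman-Pearson e-value *)

(** The derivative of a measure is nonnegative almost everywhere, so any
    version of it may be replaced by its positive part. *)
Lemma ge0_integral_RN_derivative d (T : measurableType d) (R : realType)
    (nu : {finite_measure set T -> \bar R})
    (mu : {sigma_finite_measure set T -> \bar R}) (r f : T -> \bar R) :
  nu `<< mu -> is_RN_derivative nu mu r ->
  measurable_fun [set: T] f -> (forall y, 0 <= f y) ->
  \int[nu]_y f y = \int[mu]_y (f y * maxe (r y) 0).
Proof.
move=> numu [mr rE] mf f0.
rewrite -(Radon_Nikodym_SigmaFinite.change_of_variables numu f0)//.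
have mRN : measurable_fun setT (Radon_Nikodym_SigmaFinite.f nu mu).
  by apply: measurable_int; exact: Radon_Nikodym_SigmaFinite.f_integrable.
have RN0 := Radon_Nikodym_SigmaFinite.f_ge0 numu.
apply: ge0_ae_eq_integral => //.
- exact: emeasurable_funM.
- by apply: emeasurable_funM => //; exact: measurable_maxe.
- by move=> y _; rewrite mule_ge0.
- by move=> y _; rewrite mule_ge0// le_max lexx orbT.
have := ae_eq_Radon_Nikodym_SigmaFinite numu measurableT.
move: rE; apply: filterS2 => y ry RNy _.
by rewrite ry// -RNy// max_l.
Qed.

Theorem corollary2 (R : realType) (G : topGroupType) (Y : ptopologicalType)
  (hG : second_countable_lcH G) (hY : second_countable_lcH Y)
  (cptG : compact [set: G])
  (a : continuous_action G Y)
  (mu : probability (borel G) R) (hmu : is_haar mu)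
  (Q Qbar : probability (borel Y) R)
  (hQbar : forall A : set (borel Y), measurable A ->
     Qbar A = group_average a mu Q A)
  (Qa Qs : {finite_measure set (borel Y) -> \bar R})
  (hQ : lebesgue_decomposition Q Qbar Qa Qs)
  (dQa : borel Y -> \bar R) (hdQa : is_RN_derivative Qa Qbar dQa)
  (alpha : R) (halpha : (0 < alpha <= 1)%R)
  (epsNP : borel Y -> \bar R)
  (epsNP_evalue : evalue epsNP)
  (epsNP_form : forall O : set Y, orbits a O ->
     (exists lambda k : R,
       [/\ (0 <= lambda)%R,
           (0 <= k <= alpha^-1)%R &
           \forall y \ae Unif a mu O,
             epsNP y = if dQa y < lambda%:E then 0
                       else if dQa y == lambda%:E then k%:E
                       else (alpha^-1)%:E]) /\
     \int[Unif a mu O]_y epsNP y = 1)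
  (epsNP_sing : \forall y \ae Qs, epsNP y = +oo) :
  U_optimal a Qa Qs (NP_utility alpha) epsNP.
Proof.
have [scG _ _] := hG; have [scY _ _] := hY.
have [mNP NP0] := epsNP_evalue; have [mdQa _] := hdQa.
have [_ QaQbar _] := hQ.
have c0 : (0 < alpha^-1)%R by rewrite invr_gt0; case/andP : halpha.
have orbitsE y : orbits a (Defs.orbit a y) by exists y.
have iQbar := invariant_group_average hmu scG scY hQbar.
have r0 y : 0 <= maxe (dQa y) 0 by rewrite le_max lexx orbT.
have mr : measurable_fun setT (fun y => maxe (dQa y) 0) by exact: measurable_maxe.
have U0 (e : borel Y -> \bar R) : (forall y, 0 <= e y) ->
    forall y, 0 <= NP_utility alpha (e y).
  by move=> e0 y; rewrite le_min e0 lee_fin ltW.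
have mU (e : borel Y -> \bar R) : measurable_fun setT e ->
    measurable_fun setT (fun y => NP_utility alpha (e y)).
  by move=> me; exact: measurable_mine.
split=> //.
  (* validity: the mean of epsNP is 1 on every orbit, hence under P *)
  split=> // P iP; rewrite (invariant_disintegration hmu scG scY iP mNP NP0).
  under eq_integral do rewrite (epsNP_form _ (orbitsE _)).2.
  by rewrite probability_integral_cst.
move=> eps [[meps eps0] veps] _ _ _.
have mUr e : measurable_fun setT e ->
    measurable_fun setT (fun y => NP_utility alpha (e y) * maxe (dQa y) 0).
  by move=> me; apply: emeasurable_funM => //; exact: mU.
have Ur0 (e : borel Y -> \bar R) : (forall y, 0 <= e y) ->
    forall y, 0 <= NP_utility alpha (e y) * maxe (dQa y) 0.
  by move=> e0 y; rewrite mule_ge0 ?U0.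
(* the two expected utilities are averages over orbits, compared orbitwise *)
rewrite !(ge0_integral_RN_derivative QaQbar hdQa (mU _ _) (U0 _ _))//.
rewrite !(invariant_disintegration hmu scG scY iQbar (mUr _ _) (Ur0 _ _))//.
apply: ge0_le_integral => //.
- by move=> y _; apply: integral_ge0 => z _; exact: Ur0.
- exact: (measurable_integral_Unif a hmu scG scY (mUr _ meps) (Ur0 _ eps0)).
- exact: (measurable_integral_Unif a hmu scG scY (mUr _ mNP) (Ur0 _ NP0)).
move=> y _; have [[lam [k [lam0 kc NPE]]] NP1] := epsNP_form _ (orbitsE y).
apply: (neyman_pearson c0 lam0 kc mdQa mNP (mU _ meps) NP0 _ NPE).
- by move=> z; rewrite U0//= ge_min lexx orbT.
- rewrite NP1; apply: (@le_trans _ _ (\int[Unif a mu (Defs.orbit a y)]_z eps z));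
    last exact: veps (invariant_Unif a hmu (Defs.orbit a y)).
  apply: ge0_le_integral => //.
  + by move=> z _; exact: U0.
  + exact: mU.
  + by move=> z _; rewrite ge_min lexx.
- by rewrite NP1.
Qed.
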